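(* A topological group $G$ is topologically isomorphic to the real line $\mathbb{R}$ if and only if $G$ is a non-monothetic one-parametric topological group of weight $w(G)<\mathrm{cov}(\mathcal{M})$.
   Context: All topological groups are assumed to be Hausdorff. $\mathbb{R}$ denotes the additive group of reals with the Euclidean topology. Two topological groups are topologically isomorphic if there is a group isomorphism between them that is also a homeomorphism. A topological group $G$ is one-parametric if there exists a surjective continuous group homomorphism $\phi:\mathbb{R}\to G$. A topological group $G$ is monothetic if there exists $g\in G$ such that the cyclic subgroup $\{ng:n\in\mathbb{Z}\}$ is dense in $G$. The weight $w(X)$ of a topological space $X$ is the smallest cardinality of a base of the topology of $X$. $\mathcal{M}$ is the family of all meager subsets of the real line (countable unions of nowhere dense sets), and $\mathrm{cov}(\mathcal{M})$ is the smallest cardinality of a subfamily $\mathcal{A}\subseteq\mathcal{M}$ with $\bigcup\mathcal{A}=\mathbb{R}$. *)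

(* Defs.v *)
From HB Require Import structures.
From mathcomp Require Import all_boot all_order all_algebra.
From mathcomp Require Import all_classical all_reals topology normedtype.
Import Order.TTheory GRing.Theory Num.Theory.
Import numFieldNormedType.Exports.

Set Implicit Arguments.
Unset Strict Implicit.
Unset Printing Implicit Defensive.

Local Open Scope classical_set_scope.
Local Open Scope card_scope.
Local Open Scope group_scope.

(* [topologicalZmodType] only covers abelian groups in additive notation; here
   commutativity is not assumed. *)
HB.mixin Record isTopologicalGroup G & Topological G & Group G := {
  mulg_continuous : continuous (fun x : G * G => x.1 * x.2) ;
  invg_continuous : continuous (fun x : G => x^-1) ;
}.

#[short(type="topologicalGroupType")]
HB.structure Definition TopologicalGroup :=
  {G of Topological G & Group G & isTopologicalGroup G}.

(* [to_multiplicative V] is the additive group of [V] as a [groupType]; it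
   keeps the topology of [V]. *)
HB.instance Definition _ (V : topologicalZmodType) :=
  Topological.copy (Algebra.to_multiplicative V) V.
HB.instance Definition _ (V : topologicalZmodType) :=
  isTopologicalGroup.Build (Algebra.to_multiplicative V)
    (@add_continuous V) (@opp_continuous V).

Definition topologically_isomorphic (G H : topologicalGroupType) :=
  exists f : G -> H, exists g : H -> G,
    [/\ cancel f g, cancel g f, {morph f : x y / x * y},
        continuous f & continuous g].

Definition one_parametric (R : realType) (G : topologicalGroupType) :=
  exists phi : Algebra.to_multiplicative R -> G,
    [/\ {morph phi : x y / x * y}, continuous phi &
        forall y, exists x, phi x = y].

Definition cyclic_subgroup (G : groupType) (g : G) : set G :=
  [set x | exists n : nat, x = g ^+ n \/ x = g ^- n].

Definition monothetic (G : topologicalGroupType) :=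
  exists g : G, dense (cyclic_subgroup g).

Definition nowhere_dense (X : topologicalType) (A : set X) :=
  interior (closure A) = set0.

Definition meager (X : topologicalType) (A : set X) :=
  exists F : nat -> set X,
    (forall n, nowhere_dense (F n)) /\ A = \bigcup_n F n.

(* Cardinals are not objects of the library: "the smallest cardinality of a
   member of [F]" is represented by a chosen member of [F] that injects into
   all the others.  It exists as soon as [F] is nonempty ([min_cardP]). *)
Definition min_card (T : Type) (F : set (set T)) : set T :=
  xget set0 [set A | F A /\ forall B, F B -> A #<= B].

Definition card_lt (T U : Type) (A : set T) (B : set U) : Prop :=
  A #<= B /\ ~ (B #<= A).

Definition weight (X : topologicalType) : set (set X) :=
  min_card (@basis X).
Arguments weight : clear implicits.

Definition meager_cover (R : realType) : set (set (set R)) :=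
  [set A | A `<=` @meager R /\ \bigcup_(M in A) M = setT].
Arguments meager_cover : clear implicits.

Definition covM (R : realType) : set (set R) := min_card (meager_cover R).
Arguments covM : clear implicits.

Lemma min_cardP (T : Type) (F : set (set T)) : F !=set0 ->
  F (min_card F) /\ forall B, F B -> min_card F #<= B.
Proof.
move=> F0; suff: exists A, F A /\ forall B, F B -> A #<= B by exact: xgetPex.
have [F_0|nF0] := pselect (F set0).
  by exists set0; split => // B _; exact: card_ge0.
(* a maximal set of choice functions, pairwise distinct at every [A] in [F] *)
pose P (S : set (set T -> T)) :=
  (forall s A, S s -> F A -> A (s A)) /\
  (forall s t A, S s -> S t -> F A -> s A = t A -> s = t).
have [|S [[Sin Sinj] Smax]] := @Zorn_bigcup _ P.
  move=> C CP tot; split=> [s A [X CX Xs]|s t A [X CX Xs] [Y CY Yt]] FA.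
    by have [inX _] := CP _ CX; exact: (inX s A).
  have [XY|YX] := tot _ _ CX CY.
    by have [_ inj] := CP _ CY; apply: (inj _ _ A) => //; exact: XY.
  by have [_ inj] := CP _ CX; apply: (inj _ _ A) => //; exact: YX.
have [[A [FA Asurj]]|nsurj] :=
    pselect (exists A, F A /\ forall a, A a -> exists2 s, S s & s A = a).
  exists A; split => // B FB.
  have [b Bb] : exists b, B b.
    by apply: contrapT => /forallNP B0; apply: nF0;
       rewrite -(_ : B = set0)// -subset0 => x /B0.
  have /choice[f fP] a : exists s, A a -> S s /\ s A = a.
    have [/Asurj[s Ss sA]|nAa] := pselect (A a); first by exists s.
    by exists (fun=> b) => /nAa.
  have finj : {in A &, injective (fun a => f a B)}.
    move=> x y /set_mem Ax /set_mem Ay /= fxy.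
    have [Sx <-] := fP _ Ax; have [Sy <-] := fP _ Ay.
    by rewrite (Sinj _ _ _ Sx Sy FB fxy).
  rewrite -(card_le_eql (inj_card_eq finj)).
  by apply: subset_card_le => _ [a Aa <-]; apply: (Sin _ B) => //; have [] := fP _ Aa.
exfalso.
have [A0 FA0] := F0.
have ex A : exists a, F A -> A a /\ forall s, S s -> s A <> a.
  have [FA|nFA] := pselect (F A); last first.
    have [a _] : exists a, A0 a.
      by apply: contrapT => /forallNP B0; apply: nF0;
         rewrite -(_ : A0 = set0)// -subset0 => x /B0.
    by exists a.
  apply: contrapT => /forallNP H; apply: nsurj; exists A; split => // a Aa.
  apply: contrapT => nS; apply: (H a) => _; split => // s Ss sa.
  by apply: nS; exists s.
have [t tP] := choice ex.
apply: (Smax (S `|` [set t])).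
  split=> [s Ss|h]; first by left.
  by have [_ tS] := tP _ FA0; apply: (tS t) => //; apply: h; right.
split=> [s A [Ss|->] FA|s u A [Ss|->] [Su|->] FA su //].
- exact: (Sin s A).
- by have [] := tP _ FA.
- exact: (Sinj _ _ A).
- by have [_ /(_ _ Ss)] := tP _ FA.
- by have [_ /(_ _ Su)] := tP _ FA; rewrite su.
Qed.

Lemma weightP (X : topologicalType) :
  basis (weight X) /\ forall B : set (set X), basis B -> weight X #<= B.
Proof.
apply: min_cardP; exists open; split => // x A /=; rewrite nbhsE => -[U [oU Ux] UA].
by exists U.
Qed.

Lemma covMP (R : realType) :
  meager_cover R (covM R) /\
  forall A : set (set R), meager_cover R A -> covM R #<= A.
Proof.
apply: min_cardP; exists [set [set x] | x in [set: R]]; split.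
  move=> _ [x _ <-]; exists (fun=> [set x]); split; last by rewrite bigcup_const.
  move=> _; rewrite /nowhere_dense -(closure_id _).1; last first.
    exact/accessible_closed_set1/hausdorff_accessible/Rhausdorff.
  exact: interior_set1.
by rewrite -subTset => x _; exists [set x].
Qed.

(* Main.v *)
Require Import Defs.
From mathcomp Require Import all_boot all_order all_algebra.
From mathcomp Require Import all_classical all_reals topology normedtype.
From mathcomp Require Import sequences.
From mathcomp Require Import lra.
Import Order.TTheory GRing.Theory Num.Theory.
Import numFieldNormedType.Exports.

(** Let [phi] be a continuous homomorphism of the real line onto [G].  The
    proof turns on whether some nonempty open set of [G] has a bounded preimage
    under [phi].

    If none has, [G] is monothetic ([unbounded_preimages_monothetic]).  For [U]
    open and nonempty, the set [D U] of the reals [x] such that the cyclic group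
    of [phi x] meets [U] contains the quotients [v / n] with [n] a nonzero
    integer and [v] in the preimage of [U].  It is open, and since the preimage is
    unbounded these quotients are dense ([dense_int_quotients]): dividing a
    large [v] by consecutive integers takes small steps.  The complements of
    the sets [D U], for [U] in a base of cardinality less than cov(M), are thus
    too few nowhere dense sets to cover the line, and an [x] outside all of
    them gives a generator [phi x] of a dense subgroup.

    If [U] has a bounded preimage, [phi] is injective, as its kernel translates
    that preimage into itself ([bounded_preimage_inj]), and its inverse is
    continuous ([bounded_preimage_inverse_continuous]): removing from [U] the
    image of the compact set of points in [[- M, M]] at distance at least [e]
    from a point [x0] with [phi x0] in [U] leaves a neighborhood of [phi x0]
    whose preimage lies in the ball of radius [e].  Translations carry this to
    every point.

    Conversely, the real line is one-parametric and its cyclic subgroups are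
    discrete ([not_monothetic_real]); its weight is countable, whereas cov(M)
    is not, by the Baire category theorem ([meager_cover_uncountable]). *)

Set Implicit Arguments.
Unset Strict Implicit.
Unset Printing Implicit Defensive.

Local Open Scope classical_set_scope.
Local Open Scope card_scope.
Local Open Scope ring_scope.

(** * Category and covers of the line *)

Lemma nowhere_dense_meager (X : topologicalType) (A : set X) :
  nowhere_dense A -> meager A.
Proof. by move=> nA; exists (fun=> A); split=> //; rewrite bigcup_const. Qed.

Lemma nowhere_denseC (X : topologicalType) (D : set X) :
  open D -> dense D -> nowhere_dense (~` D).
Proof.
move=> oD dD; rewrite /nowhere_dense.
rewrite -(proj1 (closure_id _) (open_closedC oD)) -subset0 => x Dx.
have [] := dD (~` D)°; [by exists x|exact: open_interior|].
by move=> y [/interior_subset].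
Qed.

Lemma dense_closureC (X : topologicalType) (A : set X) :
  nowhere_dense A -> dense (~` closure A).
Proof.
move=> nA O [x Ox] oO; apply: contrapT => /forallNP OA.
suff : interior (closure A) x by rewrite nA.
rewrite /interior nbhsE; exists O; first by split.
by move=> y Oy; apply: contrapT => Ay; exact: (OA y).
Qed.

(** Here [V] is a set of reals of arbitrarily large absolute value, and the
    quotients of its elements by integers come close to every [x <> 0]: with
    [n] the integer part of [v / x], the error [v / n - x] is at most
    [`|x| / `|n|], which is small as soon as [v] is large. *)
Lemma dense_int_quotients (R : realType) (V : set R) :
  (forall M : R, exists2 v, V v & M < `|v|) ->
  dense [set x | exists n : int, V (n%:~R * x)].
Proof.
move=> Vunb O O0 oO.
(* the estimate divides by the target, which is therefore moved off [0] *)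
have [x [Ox /eqP x0]] : O `&` ~` [set 0] !=set0 by exact: (dense_set1C 0).
have : nbhs x O by exact: open_nbhs_nbhs.
move=> /nbhs_ballP[e /= e0 eO].
have ax : 0 < `|x| by rewrite normr_gt0.
(* the bound on [v] ensures [`|n| > `|x| / e], as [n] is within [1] of
   [v / x] *)
have [v Vv Mv] := Vunb (`|x| * (`|x| / e + 1)).
pose n := Num.floor (v / x).
have /andP[n1 n2] := floor_itv (v / x); rewrite -/n intrD in n1 n2.
have vx : `|v| = `|v / x| * `|x| by rewrite -normrM divfK.
have vx1 : `|x| / e + 1 < `|v / x| by rewrite vx mulrC ltr_pM2r in Mv.
have nd : `|v / x - n%:~R| < 1.
  by rewrite ger0_norm ?subr_ge0// ltrBlDl.
have n0 : `|x| / e < `|n%:~R : R|.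
  have := ler_normD (v / x - n%:~R) n%:~R; rewrite subrK; lra.
have nn : n%:~R != 0 :> R.
  by rewrite -normr_gt0; apply: lt_trans n0; rewrite divr_gt0.
exists (v / n%:~R); split; last first.
  by exists n; rewrite /= mulrC divfK.
apply: eO; rewrite /ball /= distrC.
have -> : v / n%:~R - x = (v / x - n%:~R) * (x / n%:~R).
  by rewrite mulrBl mulrA divfK// [n%:~R * _]mulrC divfK.
rewrite normrM normrM normfV.
apply: (@le_lt_trans _ _ (`|x| / `|n%:~R|)).
  by rewrite ler_piMl ?(ltW nd)// divr_ge0.
rewrite ltr_pdivrMr ?normr_gt0// mulrC -ltr_pdivrMr//.
Qed.

(** Baire category with cov(M) in place of countability: otherwise the images
    under [F] form a meager cover, which has at least cov(M) members. *)
Lemma card_lt_covM_avoid (R : realType) (T : Type) (B : set T)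
    (F : T -> set R) : ~ (covM R #<= B) ->
  (forall U, B U -> nowhere_dense (F U)) ->
  exists x, forall U, B U -> ~ F U x.
Proof.
move=> Bsmall Fnd; apply: contrapT => /forallNP Fcov; apply: Bsmall.
apply: card_le_trans (card_image_le F B).
have [_] := covMP R; apply; split.
  by move=> _ [U BU <-]; exact/nowhere_dense_meager/Fnd.
rewrite bigcup_image -subTset => x _.
have /existsNP[U /not_implyP[BU /contrapT FU]] := Fcov x.
by exists U.
Qed.

Lemma meager_cover_uncountable (R : realType) (A : set (set R)) :
  meager_cover R A -> ~ countable A.
Proof.
move=> [Ameager Acov] cA.
have /choice[F FP] (M : set R) : exists F : nat -> set R, A M ->
    (forall n, nowhere_dense (F n)) /\ M = \bigcup_n F n.
  have [AM|nAM] := pselect (A M); last by exists (fun=> set0).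
  by have [F FM] := Ameager _ AM; exists F.
(* all the nowhere dense pieces of all the members of [A] *)
pose N := \bigcup_(M in A) range (F M).
have cN : countable N.
  by apply: bigcup_countable => // M _; exact: sub_countable (card_image_le _ _) _.
have Nnd E : N E -> nowhere_dense E by case=> M /FP[Fnd _] [n _ <-].
have Ncov x : exists2 E, N E & E x.
  have : [set: R] x by [].
  rewrite -Acov => -[M AM]; have [_ ->] := FP _ AM => -[n _ Fx].
  by exists (F M n) => //; exists M => //; exists n.
have [N0|[e]] := pfcard_geP cN; first by have [E] := Ncov 0; rewrite N0.
have eN n : N (e n) by exact: funS.
have /(@Baire R R^o)/(_ setT)[||x [_ xe]] :
    forall n, open (~` closure (e n)) /\ dense (~` closure (e n)).
- move=> n; split; first exact/closed_openC/closed_closure.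
  exact/dense_closureC/Nnd.
- by exists 0.
- exact: openT.
- have [E NE Ex] := Ncov x; have [n _ ne] := 'surj_e NE; rewrite -ne in Ex.
  by apply: (xe n) => //; exact: subset_closure.
Qed.

Lemma second_countable_real (R : realType) : @second_countable R.
Proof.
pose itv (q : rat * rat) : set R := [set` `]ratr q.1, ratr q.2[].
exists (range itv); first exact: sub_countable (card_image_le _ _) _.
split=> [_ [q _ <-]|x P]; first exact: itv_open.
move=> /nbhs_ballP[e /= e0 eP].
have [|q1] := @rat_in_itvoo R (x - e) x; first by rewrite ltrBlDr ltrDl.
have [|q2] := @rat_in_itvoo R x (x + e); first by rewrite ltrDl.
rewrite !in_itv /= => /andP[q2x q2e] /andP[q1e q1x].
exists (itv (q1, q2)).
  by split; [exists (q1, q2)|rewrite /itv /= in_itv /= q1x q2x].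
rewrite /itv => y /=; rewrite in_itv /= => /andP[y1 y2]; apply: eP.
by rewrite /ball /= ltr_norml; apply/andP; split; lra.
Qed.

(** * Homomorphisms from the line onto a topological group *)

Section one_parameter_group.
Variables (R : realType) (G : topologicalGroupType) (phi : R -> G).
Hypothesis phiD : {morph phi : x y / x + y >-> (x * y)%g}.

Lemma additive_mul0 : phi 0 = 1%g.
Proof. by apply: (mulgI (phi 0)); rewrite -phiD addr0 mulg1. Qed.

Lemma additive_mulN x : phi (- x) = (phi x)^-1%g.
Proof. by apply: (mulgI (phi x)); rewrite -phiD subrr mulgV additive_mul0. Qed.

Lemma additive_mulMn x n : phi (x *+ n) = (phi x ^+ n)%g.
Proof.
by elim: n => [|n IH]; [exact: additive_mul0|rewrite mulrS phiD IH expgS].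
Qed.

Lemma cyclic_subgroup_hom x (n : int) :
  cyclic_subgroup (phi x) (phi (n%:~R * x)).
Proof.
case: n => n; first by exists n; left; rewrite -additive_mulMn mulr_natl.
exists n.+1; right.
by rewrite NegzE mulrNz mulNr additive_mulN mulr_natl additive_mulMn.
Qed.

Hypothesis phi_cont : continuous phi.
Hypothesis phi_surj : forall y, exists x, phi x = y.

(** [phi x] generates a dense subgroup as soon as [x] lies in [D U] for every
    nonempty basic open set [U]; each [D U] is open and dense, and there are
    fewer than cov(M) of them. *)
Lemma unbounded_preimages_monothetic : ~ (covM R #<= weight G) ->
  (forall (U : set G), open U -> U !=set0 ->
     forall M, exists2 v, U (phi v) & M < `|v|) ->
  monothetic G.
Proof.
move=> wG unb.
have [Bopen Bnbhs] := (weightP G).1.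
pose D (U : set G) : set R := [set x | exists n : int, U (phi (n%:~R * x))].
(* a base may contain the empty set, for which [D] is empty *)
pose B := weight G `&` [set U | U !=set0].
have [||x Dx] := @card_lt_covM_avoid R _ B (fun U => ~` D U).
- move=> cB; apply: wG; apply: card_le_trans cB _.
  by apply: subset_card_le => U [].
- move=> U [/Bopen oU U0]; apply: nowhere_denseC.
    have -> : D U = \bigcup_(n : int) ((fun x => phi (n%:~R * x)) @^-1` U).
      by apply/seteqP; split=> x [n]; [exists n|exists n].
    apply: bigcup_open => n _; apply: open_comp => // x _.
    apply: continuous_comp (@phi_cont _).
    exact: mulrl_continuous.
  exact: (dense_int_quotients (unb _ oU U0)).
exists (phi x) => O [y Oy] oO.
have [U [BU Uy] UO] : filter_from [set U | weight G U /\ U y] id O.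
  by apply: Bnbhs; exact: open_nbhs_nbhs.
have [|n Un] := contrapT (Dx U _); first by split=> //; exists y.
by exists (phi (n%:~R * x)); split; [exact: UO|exact: cyclic_subgroup_hom].
Qed.

(** If [phi a = phi b] with [a <> b], then the preimage of [U] is invariant
    under translation by [a - b], hence unbounded. *)
Lemma bounded_preimage_inj (U : set G) (M : R) : U !=set0 ->
  (forall v, U (phi v) -> `|v| <= M) -> injective phi.
Proof.
move=> [y Uy] UM a b ab; apply/eqP; rewrite -subr_eq0; apply/negPn/negP => c0.
have [x xy] := phi_surj y.
have phic : phi (a - b) = 1%g by rewrite phiD additive_mulN ab mulgV.
pose n := Num.truncn ((M + `|x|) / `|a - b|).
have := UM (x + (a - b) *+ n.+1).
rewrite phiD additive_mulMn phic expg1n mulg1 xy => /(_ Uy).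
have := truncnS_gt ((M + `|x|) / `|a - b|); rewrite -/n.
rewrite ltr_pdivrMr ?normr_gt0// mulr_natl -normrMn.
have := ler_normB (x + (a - b) *+ n.+1) x; rewrite addrAC subrr add0r.
lra.
Qed.

(** A continuous injection of a compact set into a Hausdorff space is an
    embedding; this applies to [phi] on [[- M, M]], which contains the preimage
    of [U], and homogeneity of both groups gives the other points. *)
Lemma bounded_preimage_inverse_continuous (U : set G) (M : R) (g : G -> R) :
  hausdorff_space G -> open U -> U !=set0 ->
  (forall v, U (phi v) -> `|v| <= M) -> cancel g phi ->
  continuous g.
Proof.
move=> hG oU U0 UM gK; have phi_inj := bounded_preimage_inj U0 UM.
have phiK : cancel phi g by move=> x; apply: phi_inj; rewrite gK.
have gM y z : g (y * z)%g = g y + g z by apply: phi_inj; rewrite phiD !gK.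
case: (U0) => y0 Uy0; pose x0 := g y0.
move=> y P /nbhs_ballP[e /= e0 eP].
(* [W] is a neighborhood of [y0] whose preimage lies in [ball x0 e] *)
pose K : set R := `[- M, M]%classic `&` ~` ball x0 e.
have cK : compact (phi @` K).
  apply: continuous_compact; first exact: continuous_subspaceT.
  apply: compact_closedI; first exact: segment_compact.
  exact/open_closedC/ball_open.
pose W := U `&` ~` (phi @` K).
have oW : open W by apply: openI => //; exact/closed_openC/(compact_closed hG).
have Wball v : W (phi v) -> ball x0 e v.
  move=> [/UM vM nK]; apply: contrapT => nb; apply: nK; exists v => //.
  by split=> //=; rewrite in_itv /= -ler_norml.
have Wy0 : W y0.
  split=> // -[v [_ nb] vy0]; apply: nb.
  by rewrite /x0 -vy0 phiK; exact: ballxx.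
(* right multiplication by [c] takes [y] to [y0] and corresponds to the
   translation of the line that takes [g y] to [x0] *)
pose c := phi (x0 - g y).
have yc : (y * c)%g = y0.
  by rewrite /c -{1}[y]gK -phiD addrC subrK gK.
have : nbhs y [set z | W (z * c)%g].
  have : nbhs (y * c)%g W by rewrite yc; exact: open_nbhs_nbhs.
  have ccont : continuous (fun z : G => (z * c)%g).
    move=> z; apply: (@continuous_comp _ _ _ (fun z => (z, c))
      (fun p : G * G => (p.1 * p.2)%g)).
      by apply: cvg_pair; [exact: cvg_id|exact: cvg_cst].
    exact: mulg_continuous.
  exact: ccont.
apply: filterS => z Wz; apply: eP.
have := Wball (g (z * c)%g); rewrite gK => /(_ Wz).
rewrite gM /c phiK /ball /=; congr (`|_| < _); lra.
Qed.

End one_parameter_group.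

(** * The theorem *)

(** The image under [f] of a cyclic subgroup generated by [h] consists of the
    multiples of [f h], so it misses the open interval between [0] and
    [`|f h|], or between [0] and [1] when [f h = 0]. *)
Lemma not_monothetic_real (R : realType) (G : topologicalGroupType)
    (f : G -> R) :
  {morph f : x y / (x * y)%g >-> x + y} -> continuous f ->
  (forall x, exists y, f y = x) -> ~ monothetic G.
Proof.
move=> fD fcont fsurj [h hdense].
have f1 : f 1%g = 0 by apply: (addrI (f 1%g)); rewrite -fD mulg1 addr0.
have fV y : f y^-1%g = - f y.
  by apply: (addrI (f y)); rewrite -fD mulgV f1 subrr.
have fX y n : f (y ^+ n)%g = f y *+ n.
  by elim: n => [|n IH]; [exact: f1|rewrite expgS fD IH mulrS].
pose r : R := if f h == 0 then 1 else `|f h|.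
have r0 : 0 < r by rewrite /r; case: eqP => // /eqP; rewrite normr_gt0.
have [||z [/= zr hz]] := hdense (f @^-1` [set` `]0, r[]).
- by have [y yr] := fsurj (r / 2); exists y; rewrite /= yr in_itv /=; lra.
- by apply: open_comp => //; exact: itv_open.
move: zr; rewrite in_itv /= => /andP[z0 zr].
have [n zn] : exists n, `|f z| = `|f h| *+ n.
  by case: hz => n [->|->]; exists n; rewrite ?fV fX ?normrN normrMn.
move: zn; rewrite (gtr0_norm z0) => zn; move: zr z0; rewrite zn /r.
case: eqP => [->|_]; first by rewrite normr0 mul0rn ltxx.
case: n {zn} => [|n]; first by rewrite mulr0n ltxx.
by rewrite mulrS gtrDl ltNge mulrn_wge0.
Qed.

Theorem theorem5p2 (R : realType) (G : topologicalGroupType)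
    (G_hausdorff : hausdorff_space G) :
  topologically_isomorphic G (Algebra.to_multiplicative R) <->
  [/\ ~ monothetic G, one_parametric R G & card_lt (weight G) (covM R)].
Proof.
split=> [[f [g [fK gK fM fcont gcont]]]|[Gnm [phi [phiM phicont phisurj]] [_ wG]]].
  have gM : {morph g : x y / (x * y)%g}.
    by move=> x y; rewrite -[x in LHS]gK -[y in LHS]gK -fM fK.
  have cG : countable (weight G).
    have [B cB [Bo Bn]] := second_countable_real R.
    apply: sub_countable cB; apply: card_le_trans (card_image_le (preimage f) B).
    apply: (weightP G).2; split=> [_ [V BV <-]|y P].
      by apply: open_comp (Bo _ BV) => z _; exact: fcont.
    move=> yP; have : nbhs (f y) (g @^-1` P) by apply: gcont; rewrite fK.
    move=> /Bn[V [BV Vy] VP]; exists (f @^-1` V); first by split=> //; exists V.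
    by move=> z /VP; rewrite /= fK.
  have ncov := meager_cover_uncountable (covMP R).1.
  split.
  - apply: (@not_monothetic_real R G f fM fcont) => x.
    by exists (g x); exact: gK.
  - by exists g; split=> // y; exists (f y).
  - split; last by move=> /sub_countable/(_ cG).
    apply: card_le_trans cG _; apply/infiniteP => /finite_set_countable.
    exact: ncov.
have [[U [oU U0] [M UM]]|nb] := pselect (exists2 U : set G,
    open U /\ U !=set0 & exists M, forall v : R, U (phi v) -> `|v| <= M).
  have [g gK] := choice phisurj.
  have phi_inj := @bounded_preimage_inj R G phi phiM phisurj U M U0 UM.
  exists g, phi; split=> //.
  - by move=> x; apply: phi_inj; rewrite gK.
  - by move=> x y; apply: phi_inj; rewrite phiM !gK.
  - exact: (@bounded_preimage_inverse_continuous R G phi phiM phicont phisurj U M).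
exfalso; apply: Gnm.
apply: (@unbounded_preimages_monothetic R G phi) => // U oU U0 M.
apply: contrapT => nv; apply: nb; exists U => //; exists M => v Uv.
by rewrite leNgt; apply/negP => Mv; apply: nv; exists v.
Qed.
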